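(* Let $\mathfrak{m}$ be a finitely generated Lie algebra over a field $\mathbb{K}$ and let $i$ be a natural number. Then the following are equivalent: (i) $\gamma_{i+1}(\mathfrak{m})$ is finitely generated; (ii) there exists an $i$-central extension $0\to\mathfrak{r}\to\mathfrak{l}\to\mathfrak{m}\to 0$ of Lie algebras such that $\gamma_{i+1}(\mathfrak{l})$ is finitely generated; (iii) for every $i$-central extension $0\to\mathfrak{r}\to\mathfrak{l}\to\mathfrak{m}\to 0$ of Lie algebras, $\gamma_{i+1}(\mathfrak{l})$ is finitely generated.
   Context: $\mathbb{K}$ is a field; Lie algebras are over $\mathbb{K}$, and ''finitely generated'' means finitely generated as a Lie algebra. The lower central series of a Lie algebra $\mathfrak{m}$ is $\gamma_1(\mathfrak{m})=\mathfrak{m}$, $\gamma_{i+1}(\mathfrak{m})=[\gamma_i(\mathfrak{m}),\mathfrak{m}]$ for $i\ge 1$. For an ideal $\mathfrak{r}$ of a Lie algebra $\mathfrak{l}$, define $\gamma_1(\mathfrak{r},\mathfrak{l})=\mathfrak{r}$ and $\gamma_{i+1}(\mathfrak{r},\mathfrak{l})=[\gamma_i(\mathfrak{r},\mathfrak{l}),\mathfrak{l}]$ for $i\ge1$. An extension (short exact sequence) of Lie algebras $0\to\mathfrak{r}\to\mathfrak{l}\to\mathfrak{m}\to0$ is $i$-central if $\gamma_{i+1}(\mathfrak{r},\mathfrak{l})=0$. *)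

(* Defs.v *)
From HB Require Import structures.
From mathcomp Require Import all_boot all_algebra.
From mathcomp Require Import classical_sets.

Set Implicit Arguments.
Unset Strict Implicit.
Unset Printing Implicit Defensive.

Import GRing.Theory.
Local Open Scope ring_scope.
Local Open Scope classical_set_scope.

(* Alternating rather than antisymmetric: this is the correct axiom in every
   characteristic. *)
HB.mixin Record Lmodule_isLieAlgebra (K : fieldType) L
    of GRing.Lmodule K L := {
  lie : L -> L -> L;
  lie_linearl : forall y, linear (lie^~ y);
  lie_linearr : forall x, linear (lie x);
  lie_xx : forall x, lie x x = 0;
  lie_jacobi : forall x y z,
    lie x (lie y z) + lie y (lie z x) + lie z (lie x y) = 0
}.

#[short(type="lieAlgType")]
HB.structure Definition LieAlgebra (K : fieldType) :=
  { L of GRing.Lmodule K L & Lmodule_isLieAlgebra K L }.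

Definition lie_morphism (K : fieldType) (L M : lieAlgType K)
    (f : {linear L -> M}) : Prop :=
  {morph f : x y / lie x y}.

Section Subalgebras.
Variables (K : fieldType) (L : lieAlgType K).
Implicit Types A B : set L.

Definition is_subspace A : Prop :=
  A 0 /\ forall (a : K) x y, A x -> A y -> A (a *: x + y).

Definition is_subalgebra A : Prop :=
  is_subspace A /\ forall x y, A x -> A y -> A (lie x y).

Definition lie_comm A B : set L :=
  smallest is_subspace [set lie x y | x in A & y in B].

Definition generated_subalgebra A : set L := smallest is_subalgebra A.

Definition finitely_generated A : Prop :=
  exists s : seq L, A = generated_subalgebra [set` s].

(* gamma_n(R, L); indices start at 1, the value at n = 0 is a junk value. *)
Definition rel_lower_central A (n : nat) : set L :=
  iter n.-1 (fun B => lie_comm B setT) A.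

End Subalgebras.

Definition lower_central (K : fieldType) (L : lieAlgType K) (n : nat) : set L :=
  rel_lower_central [set: L] n.
Arguments lower_central {K} L n.

Definition lie_extension (K : fieldType) (R L M : lieAlgType K)
    (iota : {linear R -> L}) (pi : {linear L -> M}) : Prop :=
  [/\ lie_morphism iota, lie_morphism pi, injective iota,
      range iota = pi @^-1` [set 0] & range pi = setT].

Definition central_extension (i : nat) (K : fieldType) (R L M : lieAlgType K)
    (iota : {linear R -> L}) (pi : {linear L -> M}) : Prop :=
  lie_extension iota pi /\ rel_lower_central (range iota) i.+1 = [set 0].

(* Main.v *)
Require Import Defs.
From HB Require Import structures.
From mathcomp Require Import all_boot all_algebra.
From mathcomp Require Import boolp classical_sets.

Set Implicit Arguments.
Unset Strict Implicit.
Unset Printing Implicit Defensive.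

Import GRing.Theory.
Local Open Scope ring_scope.
Local Open Scope classical_set_scope.

(** The two routine implications come from maps: a surjective morphism carries
    gamma_(i+1)(L) onto gamma_(i+1)(M) and generators to generators, and the
    identity of M is an i-central extension with kernel 0, so that (i) gives
    (ii) and (iii) gives (i). The content is that finite generation lifts along
    an i-central extension pi : L -> M with kernel R
    ([finitely_generated_lower_central_lift]).

    Write N = gamma_(i+1)(L). Lift finitely many generators of M to a finite
    set X in L, and finitely many generators of gamma_(i+1)(M) to a finite set
    Y in N. The algebra L itself need not be finitely generated, since R can be
    huge, but L = <X> + R, and the part R is invisible in N: a bracket of i+1
    elements, one of which lies in R, lies in gamma_(i+1)(R, L) = 0. Hence N is
    spanned by the left-normed words of length at least i+1 in X
    ([lower_central_sub_sum]).

    It remains to find a finite subset of N that generates a subalgebra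
    containing the words of length i+1 and stable under bracketing with X. Let
    s consist of Y and of the words of length i+1. As pi maps <Y> onto
    gamma_(i+1)(M), N is contained in <Y> + R, so for y in s and x in X the
    bracket [y, x] is the sum of an element of <s> and of an error term in the
    intersection of N and R. There are finitely many error terms, and each of
    them dies after i brackets with X, so that the error terms and all their
    iterated brackets with X form a finite set F, contained in N. The elements
    of X map the generators s and F into the subalgebra generated by s and F,
    and since bracketing with an element is a derivation, that subalgebra is
    stable ([ad_closed_generated]). It is therefore equal to N. *)

(** * Brackets, subspaces and subalgebras *)

Section Basics.
Variables (K : fieldType) (L : lieAlgType K).
Implicit Types (x y z : L) (A B : set L) (X s : seq L).

Lemma lie0l x : lie 0 x = 0.
Proof.
by have := lie_linearl x (-1) 0 0; rewrite scaler0 addr0 scaleN1r addNr.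
Qed.

Lemma lie0r x : lie x 0 = 0.
Proof.
by have := lie_linearr x (-1) 0 0; rewrite scaler0 addr0 scaleN1r addNr.
Qed.

Lemma lieDl x y z : lie (x + y) z = lie x z + lie y z.
Proof. by have := lie_linearl z 1 x y; rewrite !scale1r. Qed.

Lemma lieDr x y z : lie x (y + z) = lie x y + lie x z.
Proof. by have := lie_linearr x 1 y z; rewrite !scale1r. Qed.

Lemma lieNl x y : lie (- x) y = - lie x y.
Proof. by have := lie_linearl y (-1) x 0; rewrite lie0l !addr0 !scaleN1r. Qed.

Lemma lieC x y : lie x y = - lie y x.
Proof.
have := lie_xx (x + y).
by rewrite lieDl !lieDr !lie_xx add0r addr0 => /eqP; rewrite addr_eq0 => /eqP.
Qed.

Lemma lie_derivation x y z :
  lie (lie x y) z = lie (lie x z) y + lie x (lie y z).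
Proof.
have /eqP := lie_jacobi x y z.
rewrite addr_eq0 (lieC z (lie x y)) opprK => /eqP <-.
by rewrite (lieC y (lie z x)) (lieC z x) lieNl opprK addrC.
Qed.

Lemma subspaceD A x y : is_subspace A -> A x -> A y -> A (x + y).
Proof. by move=> [_ A_lin] Ax Ay; rewrite -[x]scale1r; apply: A_lin. Qed.

Lemma subspaceN A x : is_subspace A -> A x -> A (- x).
Proof.
by move=> [A0 A_lin] Ax; rewrite -[- x]addr0 -scaleN1r; apply: A_lin.
Qed.

Lemma subspaceB A x y : is_subspace A -> A x -> A y -> A (x - y).
Proof. by move=> sA Ax Ay; apply: subspaceD => //; apply: subspaceN. Qed.

Lemma subspace_smallest (C : set L -> Prop) A :
  (forall B, C B -> is_subspace B) -> is_subspace (smallest C A).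
Proof.
move=> C_sub; split; first by move=> B [/C_sub[]].
move=> a x y Ax Ay B CB; have [/C_sub[_ B_lin] _] := CB.
by apply: B_lin; [apply: Ax | apply: Ay].
Qed.

Lemma subspace_lie_comm A B : is_subspace (lie_comm A B).
Proof. exact: subspace_smallest. Qed.

Lemma lie_comm_lie A B x y : A x -> B y -> lie_comm A B (lie x y).
Proof. by move=> Ax By; apply: sub_gen_smallest; exists x => //; exists y. Qed.

Lemma subalgebra_generated A : is_subalgebra (generated_subalgebra A).
Proof.
split; first by apply: subspace_smallest => B [].
move=> x y Ax Ay B CB; have [[_ B_lie] _] := CB.
by apply: B_lie; [apply: Ax | apply: Ay].
Qed.

Lemma subspace_sum A B : is_subspace A -> is_subspace B ->
  is_subspace [set a + b | a in A & b in B].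
Proof.
move=> [A0 A_lin] [B0 B_lin]; split.
  by exists 0 => //; exists 0 => //; rewrite addr0.
move=> c _ _ [a1 Aa1 [b1 Bb1 <-]] [a2 Aa2 [b2 Bb2 <-]].
exists (c *: a1 + a2); first exact: A_lin.
exists (c *: b1 + b2); first exact: B_lin.
by rewrite scalerDr addrACA.
Qed.

Lemma subspace_rel_lower_central A k :
  is_subspace A -> is_subspace (rel_lower_central A k.+1).
Proof. by case: k => [//|k] _; apply: subspace_lie_comm. Qed.

Lemma subspace_lower_central k : is_subspace (lower_central L k.+1).
Proof. exact: subspace_rel_lower_central. Qed.

Lemma lower_centralS k : lower_central L k.+2 `<=` lower_central L k.+1.
Proof.
elim: k => [//|k IH]; apply: smallest_sub.
  exact: subspace_lie_comm.
by move=> _ [x /IH Gx [y _ <-]]; apply: lie_comm_lie.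
Qed.

Lemma lower_central_lie k x y :
  lower_central L k.+1 x -> lower_central L k.+1 (lie x y).
Proof. by move=> Gx; apply: lower_centralS; apply: lie_comm_lie. Qed.

(** The inclusion [gamma_p(A, L), gamma_q(L)] in gamma_(p+q)(A, L): by the
    Jacobi identity, a bracket with [g, l] is a difference of successive
    brackets with g and l. This is why elements of A can stand at any position
    of a long bracket, and not only at the first one. *)
Lemma lie_rel_lower_central A j k x y :
  rel_lower_central A j.+1 x -> lower_central L k.+1 y ->
  rel_lower_central A (j + k).+2 (lie x y).
Proof.
elim: k j x y => [|k IH] j x y Ax Gy.
  by rewrite addn0; apply: lie_comm_lie.
suff : lower_central L k.+2 `<=`
    [set y | rel_lower_central A (j + k.+1).+2 (lie x y)]
  by move=> /(_ y); apply.
have subA : is_subspace (rel_lower_central A (j + k.+1).+2).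
  exact: subspace_lie_comm.
apply: smallest_sub.
  split=> [|a u v Au Av] /=; first by rewrite lie0r; case: subA.
  by rewrite lie_linearr; case: subA => _; apply.
move=> _ [g Gg [l _ <-]] /=.
have -> : lie x (lie g l) = lie (lie x g) l - lie (lie x l) g.
  by rewrite (lie_derivation x g l) addrAC subrr add0r.
apply: (subspaceB subA).
  by rewrite addnS; apply: lie_comm_lie => //; apply: IH.
by rewrite addnS -addSn; apply: IH => //; apply: lie_comm_lie.
Qed.

(** * Iterated brackets with a finite set *)

Definition ad_closed X A : Prop := forall x y, x \in X -> A y -> A (lie y x).

Definition ad_closure X A : set L :=
  smallest (fun B => is_subspace B /\ ad_closed X B) A.

(** The left-normed brackets [y, x_1, ..., x_k] with y in [s] and the x_j in
    [X], kept as a sequence so that finiteness is built in. *)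
Definition brackets X k s : seq L :=
  iter k (fun t => [seq lie y x | y <- t, x <- X]) s.

(** As [brackets X k X] lists the left-normed words of length k+1 in [X], this
    is the span of all left-normed words of length at least k+1. *)
Definition word_span X k : set L := ad_closure X [set` brackets X k X].

Lemma mem_brackets X k s x y :
  x \in X -> y \in brackets X k s -> lie y x \in brackets X k.+1 s.
Proof. by move=> Xx sy; apply/allpairsP; exists (y, x). Qed.

Lemma bracketsP X k s w : w \in brackets X k.+1 s ->
  exists y x, [/\ y \in brackets X k s, x \in X & w = lie y x].
Proof. by move=> /allpairsP[[y x] /= [sy Xx ->]]; exists y, x. Qed.

Lemma brackets_rel_lower_central X A k s :
  [set` s] `<=` A -> [set` brackets X k s] `<=` rel_lower_central A k.+1.
Proof.
move=> sA; elim: k => [//|k IH] _ /bracketsP[y [x [sy _ ->]]].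
by apply: lie_comm_lie => //; apply: IH.
Qed.

Lemma subspace_ad_closure X A : is_subspace (ad_closure X A).
Proof. by apply: subspace_smallest => B []. Qed.

Lemma ad_closed_ad_closure X A : ad_closed X (ad_closure X A).
Proof.
by move=> x y Xx Ay B CB; have [[_ B_ad] _] := CB; apply: B_ad => //; apply: Ay.
Qed.

Lemma word_span_lie_gen X k x y :
  x \in X -> word_span X k y -> word_span X k.+1 (lie y x).
Proof.
suff : word_span X k `<=`
    [set y | forall x, x \in X -> word_span X k.+1 (lie y x)].
  by move=> sub Xx Wy; apply: (sub y Wy).
have [W0 W_lin] := subspace_ad_closure X [set` brackets X k.+1 X].
apply: smallest_sub; first split; first split.
- by move=> z _; rewrite lie0l.
- move=> a u v Wu Wv z Xz; rewrite lie_linearl.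
  by apply: W_lin; [apply: Wu | apply: Wv].
- by move=> z u Xz Wu t Xt; apply: ad_closed_ad_closure => //; apply: Wu.
- by move=> u Xu z Xz; apply: sub_gen_smallest; apply: mem_brackets.
Qed.

Lemma word_spanS X k : word_span X k.+1 `<=` word_span X k.
Proof.
apply: smallest_sub.
  by split; [apply: subspace_ad_closure | apply: ad_closed_ad_closure].
move=> _ /bracketsP[y [x [sy Xx ->]]].
by apply: ad_closed_ad_closure => //; apply: sub_gen_smallest.
Qed.

(** The elements x whose bracket raises the filtration by word length at every
    level form a subalgebra containing [X]: by the Jacobi identity, [w, [u, v]]
    is even two levels higher than w. *)
Lemma word_span_lie X k x y :
  generated_subalgebra [set` X] x -> word_span X k y ->
  word_span X k.+1 (lie y x).
Proof.
suff : generated_subalgebra [set` X] `<=`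
    [set x | forall k y, word_span X k y -> word_span X k.+1 (lie y x)].
  by move=> sub gx; apply: (sub x gx).
apply: smallest_sub; first split; first split.
- by move=> j u _; rewrite lie0r; case: (subspace_ad_closure X
    [set` brackets X j.+1 X]).
- move=> a u v Wu Wv j w Ww; rewrite lie_linearr.
  have [_ W_lin] := subspace_ad_closure X [set` brackets X j.+1 X].
  by apply: W_lin; [apply: Wu | apply: Wv].
- move=> u v Wu Wv j w Ww.
  have -> : lie w (lie u v) = lie (lie w u) v - lie (lie w v) u.
    by rewrite (lie_derivation w u v) addrAC subrr add0r.
  apply: word_spanS; apply: (subspaceB (subspace_ad_closure _ _)).
    by apply: Wv; apply: Wu.
  by apply: Wu; apply: Wv.
- by move=> u Xu j w; apply: word_span_lie_gen.
Qed.

(** Left-normed words span the generated subalgebra. The induction keeps track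
    of membership in both sets, because [word_span_lie] needs one factor in
    each. *)
Lemma generated_sub_word_span X :
  generated_subalgebra [set` X] `<=` word_span X 0.
Proof.
have [gen_sub gen_lie] := subalgebra_generated [set` X].
have [W0 W_lin] := subspace_ad_closure X [set` brackets X 0 X].
suff : generated_subalgebra [set` X] `<=`
    generated_subalgebra [set` X] `&` word_span X 0 by move=> sub x /sub[].
apply: smallest_sub; first split; first split.
- by split => //; case: gen_sub.
- move=> a u v [gu Wu] [gv Wv]; split; last exact: W_lin.
  by case: gen_sub => _; apply.
- move=> u v [gu Wu] [gv _]; split; first exact: gen_lie.
  by apply: word_spanS; apply: word_span_lie.
- by move=> u Xu; split; apply: sub_gen_smallest.
Qed.

Lemma word_span_sub_lower_central X k :
  word_span X k `<=` lower_central L k.+1.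
Proof.
apply: smallest_sub; last exact: brackets_rel_lower_central.
split; first exact: subspace_lower_central.
by move=> x y _; apply: lower_central_lie.
Qed.

(** If [X] generates L modulo A, then [X] determines gamma_(k+1)(L) modulo
    gamma_(k+1)(A, L). The mixed terms [w, a], with w a word of length at least
    k+1 and a in A, are absorbed by [lie_rel_lower_central]. *)
Lemma lower_central_sub_sum X A k :
  (forall x, exists2 y, generated_subalgebra [set` X] y & A (x - y)) ->
  lower_central L k.+1 `<=`
    [set w + a | w in word_span X k & a in rel_lower_central A k.+1].
Proof.
move=> gen_modA; elim: k => [|k IH].
  move=> x _; have [y gy Axy] := gen_modA x.
  exists y; first exact: generated_sub_word_span.
  by exists (x - y) => //; rewrite addrC subrK.
apply: smallest_sub.
  apply: subspace_sum; first exact: subspace_ad_closure.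
  exact: subspace_lie_comm.
move=> _ [_ /IH[w Ww [a Aa <-]] [x _ <-]].
have [y gy Axy] := gen_modA x.
exists (lie w y); first exact: word_span_lie.
exists (lie a x + lie w (x - y)); last first.
  by rewrite addrCA -lieDr [y + _]addrC subrK lieDl addrC.
have subA : is_subspace (rel_lower_central A k.+2) by apply: subspace_lie_comm.
apply: (subspaceD subA); first exact: lie_comm_lie.
rewrite lieC; apply: (subspaceN subA);
exact: (@lie_rel_lower_central A 0 k _ _ Axy (word_span_sub_lower_central Ww)).
Qed.

(** Bracketing with x is a derivation, so it preserves a subalgebra as soon as
    it maps the generators into it. *)
Lemma generated_lie_gen A x :
  (forall y, A y -> generated_subalgebra A (lie y x)) ->
  forall y, generated_subalgebra A y -> generated_subalgebra A (lie y x).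
Proof.
move=> gen_x; have [[g0 g_lin] gen_lie] := subalgebra_generated A.
suff : generated_subalgebra A `<=`
    [set y | generated_subalgebra A y /\ generated_subalgebra A (lie y x)].
  by move=> sub y /sub[].
apply: smallest_sub; first split; first split.
- by split=> //; rewrite lie0l.
- move=> a u v [gu gux] [gv gvx]; split; first exact: g_lin.
  by rewrite lie_linearl; apply: g_lin.
- move=> u v [gu gux] [gv gvx]; split; first exact: gen_lie.
  rewrite lie_derivation.
  by apply: (subspaceD (conj g0 g_lin)); apply: gen_lie.
- by move=> u Au; split; [apply: sub_gen_smallest | apply: gen_x].
Qed.

Lemma brackets_sub_ad_closure X k s :
  [set` brackets X k s] `<=` ad_closure X [set` s].
Proof.
elim: k => [|k IH] => [|_ /bracketsP[y [x [sy Xx ->]]]].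
  exact: sub_gen_smallest.
by apply: ad_closed_ad_closure => //; apply: IH.
Qed.

(** If bracketing with [X] preserves the subalgebra generated by [s] up to
    finitely many error terms, listed in [t], on which [X] acts nilpotently,
    then adding to [s] the error terms and their iterated brackets with [X]
    makes the subalgebra stable. Nilpotency is what keeps the added set
    finite. *)
Lemma ad_closed_generated X s t k :
  (forall y x, y \in s -> x \in X -> exists2 z, z \in t &
     generated_subalgebra [set` s] (lie y x - z)) ->
  [set` brackets X k t] `<=` [set 0] ->
  exists2 F : seq L, [set` F] `<=` ad_closure X [set` t] &
    ad_closed X (generated_subalgebra [set` s ++ F]).
Proof.
move=> s_ad t_nil.
pose F := flatten [seq brackets X j t | j <- iota 0 k.+1].
have memF j w : (j <= k)%N -> w \in brackets X j t -> w \in F.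
  move=> le_jk tw; apply/flatten_mapP; exists j => //.
  by rewrite mem_iota.
exists F => [w /flatten_mapP[j _ tw]|]; first exact: brackets_sub_ad_closure tw.
have [gen_sub _] := subalgebra_generated [set` s ++ F].
have genF w : w \in F -> generated_subalgebra [set` s ++ F] w.
  by move=> Fw; apply: sub_gen_smallest => /=; rewrite mem_cat Fw orbT.
move=> x y Xx; apply: generated_lie_gen y => y /=.
rewrite mem_cat => /orP[sy|/flatten_mapP[j]].
  have [z tz gz] := s_ad y x sy Xx.
  rewrite -[lie y x](subrK z); apply: (subspaceD gen_sub).
    apply: sub_smallest2r gz; first exact: subalgebra_generated.
    by move=> w /= sw; rewrite mem_cat sw.
  by apply: genF; apply: (memF 0%N).
rewrite mem_iota add0n ltnS /= leq_eqVlt => /orP[/eqP->|lt_jk] ty.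
  by have -> := t_nil y ty; rewrite lie0l; case: gen_sub.
by apply: genF; apply: (memF j.+1) => //; apply: mem_brackets.
Qed.

End Basics.

(** * Surjective morphisms *)

Section Morphisms.
Variables (K : fieldType) (L M : lieAlgType K) (pi : {linear L -> M}).
Hypothesis pi_lie : lie_morphism pi.

Lemma subspace_preimage (B : set M) :
  is_subspace B -> is_subspace (pi @^-1` B).
Proof.
move=> [B0 B_lin]; split=> [|a x y Bx By] /=; first by rewrite linear0.
by rewrite linearP; apply: B_lin.
Qed.

Lemma subspace_image (A : set L) : is_subspace A -> is_subspace (pi @` A).
Proof.
move=> [A0 A_lin]; split; first by exists 0 => //; rewrite linear0.
move=> a _ _ [x Ax <-] [y Ay <-].
by exists (a *: x + y); [apply: A_lin | rewrite linearP].
Qed.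

Lemma image_generated (A : set L) :
  pi @` generated_subalgebra A = generated_subalgebra (pi @` A).
Proof.
apply/seteqP; split.
  rewrite image_sub; apply: smallest_sub; last first.
    by move=> x Ax; apply: sub_gen_smallest; exists x.
  have [g_sub g_lie] := subalgebra_generated (pi @` A).
  split; first exact: subspace_preimage.
  by move=> x y gx gy /=; rewrite pi_lie; apply: g_lie.
apply: smallest_sub; last by apply: image_subset; apply: sub_gen_smallest.
have [g_sub g_lie] := subalgebra_generated A.
split; first exact: subspace_image.
move=> _ _ [x gx <-] [y gy <-].
by exists (lie x y); [apply: g_lie | rewrite pi_lie].
Qed.

Lemma finitely_generated_image (A : set L) :
  finitely_generated A -> finitely_generated (pi @` A).
Proof.
move=> [s ->]; exists (map pi s).
rewrite image_generated; congr (generated_subalgebra _).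
apply/seteqP; split=> [_ [x sx <-]|_ /mapP[x sx ->]]; first exact: map_f.
by exists x.
Qed.

Lemma image_lower_central k : range pi = setT ->
  pi @` lower_central L k.+1 = lower_central M k.+1.
Proof.
move=> pi_surj; elim: k => [//|k IH]; apply/seteqP; split.
  rewrite image_sub; apply: smallest_sub.
    by apply: subspace_preimage; apply: subspace_lie_comm.
  move=> _ [x Gx [y _ <-]] /=; rewrite pi_lie; apply: lie_comm_lie => //.
  by change (lower_central M k.+1 (pi x)); rewrite -IH; exists x.
apply: smallest_sub; first by apply: subspace_image; apply: subspace_lie_comm.
move=> _ [u Gu [v _ <-]].
have [x Gx <-] : (pi @` lower_central L k.+1) u by rewrite IH.
have [y _ <-] : range pi v by rewrite pi_surj.
by exists (lie x y); [apply: lie_comm_lie | rewrite pi_lie].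
Qed.

(** Lifting a finite generating set of [pi @` A] to A: the lifts generate A
    modulo the kernel of [pi]. *)
Lemma lift_generators (A : set L) : finitely_generated (pi @` A) ->
  exists2 s : seq L, [set` s] `<=` A &
    forall x, A x ->
      exists2 y, generated_subalgebra [set` s] y & pi (x - y) = 0.
Proof.
move=> [t tE].
have t_im u : exists x, u \in t -> A x /\ pi x = u.
  have [tu|] := boolP (u \in t); last by exists 0.
  suff [x Ax <-] : (pi @` A) u by exists x.
  by rewrite tE; apply: sub_gen_smallest.
have [f fP] := choice t_im.
exists (map f t) => [_ /mapP[u tu ->]|x Ax]; first by case: (fP u tu).
have : (pi @` A) (pi x) by exists x.
have -> : pi @` A = pi @` generated_subalgebra [set` map f t].
  rewrite tE image_generated; congr (generated_subalgebra _).
  apply/seteqP; split=> [u tu|_ [_ /mapP[u tu ->] <-]].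
    by exists (f u); [apply: map_f | case: (fP u tu)].
  by case: (fP u tu) => _ ->.
by move=> [y gy piE]; exists y => //; rewrite linearB /= piE subrr.
Qed.

(** Finite generation of gamma_(i+1) lifts along a surjection whose kernel R
    satisfies gamma_(i+1)(R, L) = 0. *)
Lemma finitely_generated_lower_central_lift i :
  range pi = setT -> rel_lower_central (pi @^-1` [set 0]) i.+1 `<=` [set 0] ->
  finitely_generated [set: M] -> finitely_generated (lower_central M i.+1) ->
  finitely_generated (lower_central L i.+1).
Proof.
move=> pi_surj ker_nil.
rewrite -{1}pi_surj => /lift_generators[X _ X_gen].
rewrite -image_lower_central // => /lift_generators[Y Y_low Y_gen].
set N := lower_central L i.+1 in Y_low Y_gen *.
have N_sub : is_subspace N by apply: subspace_lower_central.
have N_lie x y : N x -> N (lie x y) by apply: lower_central_lie.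
pose s := Y ++ brackets X i X.
have s_low : [set` s] `<=` N.
  move=> y /=; rewrite mem_cat => /orP[/Y_low//|].
  exact: brackets_rel_lower_central.
(* N is an ideal, hence a subalgebra. *)
have gen_low u : [set` u] `<=` N -> generated_subalgebra [set` u] `<=` N.
  by move=> uN; apply: smallest_sub => //; split=> // x y Nx _; apply: N_lie.
(* The error term e (y, x) is [y, x] minus an element of <Y> with the same
   image in M. *)
have /choice[e eP] (p : L * L) : exists z, p.1 \in s ->
    [/\ N z, pi z = 0 & generated_subalgebra [set` s] (lie p.1 p.2 - z)].
  have [sp|] := boolP (p.1 \in s); last by exists 0.
  have Np : N (lie p.1 p.2) by apply: N_lie; apply: s_low.
  have [n Yn pi_n] := Y_gen _ Np.
  exists (lie p.1 p.2 - n) => _; rewrite subKr; split=> //.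
    by apply: subspaceB => //; apply: gen_low Yn.
  apply: sub_smallest2r Yn; first exact: subalgebra_generated.
  by move=> y /= Yy; rewrite mem_cat Yy.
pose t := [seq e (y, x) | y <- s, x <- X].
have tP z : z \in t -> N z /\ pi z = 0.
  by move=> /allpairsP[[y x] /= [sy _ ->]]; have [] := eP (y, x) sy.
have [||F F_low F_ad] := @ad_closed_generated _ _ X s t i.
- move=> y x sy Xx; exists (e (y, x)); last by have [] := eP (y, x) sy.
  by apply/allpairsP; exists (y, x).
- apply: subset_trans ker_nil; apply: brackets_rel_lower_central.
  by move=> z /tP[].
have [gen_sub _] := subalgebra_generated [set` s ++ F].
exists (s ++ F); apply/seteqP; split; last first.
  apply: gen_low => y /=; rewrite mem_cat => /orP[/s_low//|/F_low].
  apply: smallest_sub y; last by move=> z /tP[].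
  by split=> // x y _; apply: N_lie.
(* As gamma_(i+1)(R, L) = 0, only words in X contribute to N. *)
have : N `<=` word_span X i.
  move=> x Nx; have [|w Ww [a /ker_nil -> <-]] :=
    @lower_central_sub_sum _ _ X (pi @^-1` [set 0]) i _ x Nx.
    by move=> u; apply: X_gen.
  by rewrite addr0.
move=> /subset_trans; apply; apply: smallest_sub; first by [].
by move=> w Xw; apply: sub_gen_smallest => /=; rewrite !mem_cat Xw orbT.
Qed.

End Morphisms.

(** * The trivial extension *)

(** Row vectors of width 0 provide the vector space 0 over any field. *)
Definition zero_lie (K : fieldType) : Type := 'rV[K]_0.

HB.instance Definition _ (K : fieldType) := GRing.Lmodule.on (zero_lie K).

Section ZeroLie.
Variable K : fieldType.
Implicit Types x y z : zero_lie K.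

Definition zero_bracket x y : zero_lie K := 0.

Lemma zero_bracket_linearl y : linear (zero_bracket^~ y).
Proof. by move=> a u v; rewrite /zero_bracket scaler0 addr0. Qed.

Lemma zero_bracket_linearr x : linear (zero_bracket x).
Proof. by move=> a u v; rewrite /zero_bracket scaler0 addr0. Qed.

Lemma zero_bracket_xx x : zero_bracket x x = 0.
Proof. by []. Qed.

Lemma zero_bracket_jacobi x y z :
  zero_bracket x (zero_bracket y z) + zero_bracket y (zero_bracket z x) +
  zero_bracket z (zero_bracket x y) = 0.
Proof. by rewrite !addr0. Qed.

HB.instance Definition _ := Lmodule_isLieAlgebra.Build K (zero_lie K)
  zero_bracket_linearl zero_bracket_linearr zero_bracket_xx
  zero_bracket_jacobi.

End ZeroLie.

Lemma central_extension_idfun (K : fieldType) (M : lieAlgType K) i :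
  central_extension i (\0 : {linear zero_lie K -> M}) (idfun : {linear M -> M}).
Proof.
have range0 : range (\0 : zero_lie K -> M) = [set 0].
  by apply/seteqP; split=> [_ [x _ <-]|_ ->] //; exists 0.
split.
  split=> //; first by move=> x y /=; rewrite lie0l.
  - by move=> x y _; rewrite [x]thinmx0 [y]thinmx0.
  - by rewrite image_id.
rewrite range0; elim: i => [//|i IH]; apply/seteqP; split.
  apply: smallest_sub; first by split=> // a x y -> ->; rewrite scaler0 addr0.
  move=> _ [x Ax [y _ <-]]; have -> : [set 0] x by rewrite -IH.
  by rewrite lie0l.
by move=> _ ->; case: (@subspace_lie_comm K M
  (rel_lower_central [set 0] i.+1) setT).
Qed.

Theorem theorem3p12 (K : fieldType) (M : lieAlgType K) (i : nat)
    (fgM : finitely_generated [set: M]) :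
  [<-> finitely_generated (lower_central M i.+1);
       exists (R L : lieAlgType K)
              (iota : {linear R -> L}) (pi : {linear L -> M}),
         central_extension i iota pi /\
         finitely_generated (lower_central L i.+1);
       forall (R L : lieAlgType K)
              (iota : {linear R -> L}) (pi : {linear L -> M}),
         central_extension i iota pi ->
         finitely_generated (lower_central L i.+1)].
Proof.
tfae.
- move=> fg; exists (zero_lie K), M, \0, idfun; split=> //.
  exact: central_extension_idfun.
(* Through (i): push generators down the given extension, then lift them
   along the other one. *)
- move=> [R [L [iota [pi [[[_ pi_lie _ _ pi_surj] _] fgL]]]]].
  move=> R' L' iota' pi' [[_ pi'_lie _ ker_pi' pi'_surj]].
  rewrite ker_pi' => ker_nil.
  apply: (finitely_generated_lower_central_lift pi'_lie) => //.
    by rewrite ker_nil.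
  rewrite -(image_lower_central pi_lie i pi_surj).
  exact: finitely_generated_image.
- move=> fg; exact: fg (central_extension_idfun M i).
Qed.
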